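(* Let $m$ and $r$ be natural numbers with $m\ge 2r$, let $n:=mr$, and let $k\in[m]$. (a) For every positive semidefinite $\mathbf{M}^*\in\mathbb{R}^{n\times n}$ of rank $r$ such that $\mathbf{M}^*_{i,j}$ has full rank for all $i,j\in[m]$, the instance $\mathcal{P}_{\mathbf{M}^*,\tilde\Omega_k,n,r}$ belongs to $\mathcal{L}(\tilde{\mathcal{G}}_k,n,r)$. (b) There exists such an instance for which the problem $\min_{\mathbf{X}\in\mathbb{R}^{n\times r}}\|(\mathbf{X}\mathbf{X}^T-\mathbf{M}^* )_{\tilde\Omega_k}\|_F^2$ has at least $2^{r(m-2)}-1$ equivalence classes of spurious local minima, while the problem with the smaller measurement set, $\min_{\mathbf{X}\in\mathbb{R}^{n\times r}}\|(\mathbf{X}\mathbf{X}^T-\mathbf{M}^* )_{\Omega_k}\|_F^2$, has no spurious solutions.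
   Context: $[m]=\{1,\dots,m\}$. An $n\times n$ matrix $\mathbf{M}$ with $n=mr$ is divided into $m\times m$ blocks $\mathbf{M}_{i,j}$ of size $r\times r$. For $\Omega\subset[n]\times[n]$, $\mathbf{M}_\Omega$ denotes the matrix whose $(i,j)$ entry is $\mathbf{M}_{ij}$ if $(i,j)\in\Omega$ and $0$ otherwise. The problem $\mathcal{P}_{\mathbf{M}^*,\Omega,n,r}$ is: find $\mathbf{M}\in\mathbb{R}^{n\times n}$ with $\mathrm{rank}(\mathbf{M})\le r$, $\mathbf{M}\succeq 0$, $\mathbf{M}_\Omega=\mathbf{M}^*_\Omega$. For a pair $\mathcal{G}=(\mathcal{V},\mathcal{E}_1,\mathcal{E}_2)$ of undirected graphs (self-loops allowed) on $\mathcal{V}=[m]$ with disjoint edge sets, $\mathcal{G}_1=(\mathcal{V},\mathcal{E}_1)$, the induced measurement set $\Omega(\mathcal{G})$ consists (when $n=mr$) of all entries of blocks $(i,j)\in\mathcal{E}_1$ and all nondiagonal entries of the blocks $(i,j)\in\mathcal{E}_2$. The class $\mathcal{L}(\mathcal{G},n,r)$ consists of the problems $\mathcal{P}_{\mathbf{M}^*,\Omega,n,r}$ such that: (i) $\mathbf{M}^*$ is PSD of rank $r$; (ii) $\mathbf{M}^*_{i,j}$ has rank $r$ for all $i,j\in[m]$; (iii) $\Omega=\Omega(\mathcal{G})$ with $\mathcal{G}_1$ connected and non-bipartite (a self-loop counts as an odd cycle). Let $\mathcal{E}_k:=\{(k,j),(j,k)\mid j\in[m]\}$ and let $\Omega_k$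 be the set of all entries of blocks $(i,j)\in\mathcal{E}_k$. Let $\tilde{\mathcal{E}}_k:=\mathcal{E}_k\cup\{(i,i)\mid i\in[m]\}$, $\mathcal{E}_2:=\{(i,j)\mid i,j\in[m],\ i\ne j\}\setminus\tilde{\mathcal{E}}_k$, $\tilde{\mathcal{G}}_k:=([m],\tilde{\mathcal{E}}_k,\mathcal{E}_2)$ and $\tilde\Omega_k:=\Omega(\tilde{\mathcal{G}}_k)$. A solution is spurious if it is a local minimum with objective value larger than the optimal objective value. Two points $\mathbf{X},\mathbf{X}'\in\mathbb{R}^{n\times r}$ are equivalent if $\mathbf{X}'=\mathbf{X}\mathbf{Q}$ for some orthogonal $\mathbf{Q}\in\mathbb{R}^{r\times r}$. *)

(* Defs.v *)
From HB Require Import structures.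
From mathcomp Require Import all_boot all_order all_algebra.
From mathcomp Require Import all_classical all_reals all_analysis.

Set Implicit Arguments.
Unset Strict Implicit.
Unset Printing Implicit Defensive.

Import Order.TTheory GRing.Theory Num.Theory.
Import numFieldNormedType.Exports.

Local Open Scope classical_set_scope.
Local Open Scope ring_scope.

Definition psd (R : realType) n (M : 'M[R]_n) : Prop :=
  M^T = M /\ forall x : 'cV[R]_n, 0 <= (x^T *m M *m x) 0 0.

Definition restrict (R : realType) n (Omega : {set 'I_n * 'I_n}) (M : 'M[R]_n)
    : 'M[R]_n :=
  \matrix_(p, q) if (p, q) \in Omega then M p q else 0.

Definition frobenius (R : realType) n1 n2 (M : 'M[R]_(n1, n2)) : R :=
  Num.sqrt (\sum_p \sum_q M p q ^+ 2).

(* Indices are 0-based: offset a of block i is the row (or column) i * r + a,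
   which is what mxvec_index computes. *)
Lemma mxvec_index_val m r (i : 'I_m) (a : 'I_r) :
  mxvec_index i a = (i * r + a)%N :> nat.
Proof.
have aux (S T : eqType) (s : seq S) (t : seq T) x y : x \in s -> y \in t ->
    index (x, y) [seq (u, v) | u <- s, v <- t] =
    (index x s * size t + index y t)%N.
  move=> xs yt; elim: s xs => //= u s IHs.
  rewrite inE index_cat size_map [u == x]eq_sym.
  have [-> _|/= xu xs] := eqVneq x u.
    by rewrite map_f // index_map // => ? ? [].
  case: mapP => [[v _ [xE]]|_]; first by rewrite xE eqxx in xu.
  by rewrite IHs // mulSn addnA.
rewrite /mxvec_index /= /enum_rank [enum_rank_in]unlock insubdK; last first.
  by rewrite cardE [_ \in _]index_mem mem_enum.
rewrite [enum _]enumT unlock /= /prod_enum aux ?mem_enum //.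
by rewrite !index_enum_ord size_enum_ord.
Qed.

Definition block (R : realType) m r (M : 'M[R]_(m * r)) (i j : 'I_m)
    : 'M[R]_r :=
  \matrix_(a, b) M (mxvec_index i a) (mxvec_index j b).

(* The matrix completion problem with ground truth M* and measurement set
   Omega; n and r are carried by the type. *)
Record problem (R : realType) (n r : nat) := Problem {
  truth : 'M[R]_n;
  measured : {set 'I_n * 'I_n}
}.
Arguments Problem {R n} r truth measured.

Definition solution (R : realType) n r (P : problem R n r) (M : 'M[R]_n)
    : Prop :=
  [/\ (\rank M <= r)%N, psd M
    & restrict (measured P) M = restrict (measured P) (truth P)].

Definition objective (R : realType) n r (P : problem R n r) (X : 'M[R]_(n, r))
    : R :=
  frobenius (restrict (measured P) (X *m X^T - truth P)) ^+ 2.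

(* An undirected edge {i, j} is encoded by both pairs (i, j) and (j, i);
   loops (i, i) are allowed. *)
Record graph_pair (m : nat) := GraphPair {
  edges1 : {set 'I_m * 'I_m};
  edges2 : {set 'I_m * 'I_m};
  edges1_sym : forall i j, ((i, j) \in edges1) = ((j, i) \in edges1);
  edges2_sym : forall i j, ((i, j) \in edges2) = ((j, i) \in edges2);
  edges_disjoint : forall e, e \in edges1 -> e \notin edges2
}.

Definition connected_graph m (E : {set 'I_m * 'I_m}) : Prop :=
  forall i j : 'I_m, connect [rel u v | (u, v) \in E] i j.

(* A loop rules out any such colouring. *)
Definition bipartite m (E : {set 'I_m * 'I_m}) : Prop :=
  exists c : 'I_m -> bool, forall i j, (i, j) \in E -> c i != c j.

Definition entry m r (e : 'I_m * 'I_m) (s : 'I_r * 'I_r)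
    : 'I_(m * r) * 'I_(m * r) :=
  (mxvec_index e.1 s.1, mxvec_index e.2 s.2).

Definition all_entries m r (E : {set 'I_m * 'I_m})
    : {set 'I_(m * r) * 'I_(m * r)} :=
  [set entry e s | e in E, s in [set: 'I_r * 'I_r]]%SET.

Definition nondiagonal_entries m r (E : {set 'I_m * 'I_m})
    : {set 'I_(m * r) * 'I_(m * r)} :=
  [set entry e s | e in E, s in [set s : 'I_r * 'I_r | s.1 != s.2]]%SET.

Definition induced_measurements m r (G : graph_pair m)
    : {set 'I_(m * r) * 'I_(m * r)} :=
  all_entries r (edges1 G) :|: nondiagonal_entries r (edges2 G).

Definition class_L (R : realType) m r (G : graph_pair m)
    (P : problem R (m * r) r) : Prop :=
  [/\ psd (truth P) /\ \rank (truth P) = r,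
      forall i j : 'I_m, \rank (block (truth P) i j) = r,
      measured P = induced_measurements r G
    & connected_graph (edges1 G) /\ ~ bipartite (edges1 G)].

Definition star_edges m (k : 'I_m) : {set 'I_m * 'I_m} :=
  [set e : 'I_m * 'I_m | (e.1 == k) || (e.2 == k)]%SET.

Definition star_loop_edges m (k : 'I_m) : {set 'I_m * 'I_m} :=
  star_edges k :|: [set e : 'I_m * 'I_m | e.1 == e.2]%SET.

Definition star_other_edges m (k : 'I_m) : {set 'I_m * 'I_m} :=
  [set e : 'I_m * 'I_m | e.1 != e.2]%SET :\: star_loop_edges k.

Lemma star_loop_edges_sym m (k : 'I_m) i j :
  ((i, j) \in star_loop_edges k) = ((j, i) \in star_loop_edges k).
Proof. by rewrite !inE /= orbC (eq_sym i j) [(i == k) || _]orbC orbC. Qed.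

Lemma star_other_edges_sym m (k : 'I_m) i j :
  ((i, j) \in star_other_edges k) = ((j, i) \in star_other_edges k).
Proof. by rewrite !finset.in_setD star_loop_edges_sym !inE /= (eq_sym i j). Qed.

Lemma star_edges_disjoint m (k : 'I_m) e :
  e \in star_loop_edges k -> e \notin star_other_edges k.
Proof. by move=> ek; rewrite finset.in_setD ek. Qed.

Definition star_graph m (k : 'I_m) : graph_pair m :=
  GraphPair (@star_loop_edges_sym m k) (@star_other_edges_sym m k)
            (@star_edges_disjoint m k).

Definition Omega_star m r (k : 'I_m) : {set 'I_(m * r) * 'I_(m * r)} :=
  all_entries r (star_edges k).

Definition Omega_tilde m r (k : 'I_m) : {set 'I_(m * r) * 'I_(m * r)} :=
  induced_measurements r (star_graph k).

Definition local_min (R : realType) n r (f : 'M[R]_(n, r) -> R)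
    (X : 'M[R]_(n, r)) : Prop :=
  \forall Y \near X, f X <= f Y.

Definition spurious (R : realType) n r (f : 'M[R]_(n, r) -> R)
    (X : 'M[R]_(n, r)) : Prop :=
  local_min f X /\ inf (range f) < f X.

Definition equivalent (R : realType) n r (X X' : 'M[R]_(n, r)) : Prop :=
  exists2 Q : 'M[R]_r, Q^T *m Q = 1%:M & X' = X *m Q.

Definition spurious_classes (R : realType) n r (f : 'M[R]_(n, r) -> R)
    : set (set 'M[R]_(n, r)) :=
  [set [set X' | equivalent X X'] | X in [set X | spurious f X]].

(* Main.v *)
(* The ground truth is [W W^T] where block [k] of [W] is [eps] times the
   identity and the other blocks are identities.  With [eps = 0] the larger
   problem is minimized exactly, up to rotation, by [X_k = 0] and the other
   blocks diagonal with entries [+-1]; after normalizing one block [j0] this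
   leaves [2 ^ (r (m - 2))] isolated rotation classes.  For small [eps] each
   class still carries a local minimum, separated from the others by the signs
   of the inner products [<x_(j0,a), x_(j,a)>], while only the all-plus pattern
   reaches the value 0.  For the star [Omega_k], criticality says that the
   masked residual annihilates [X]: if [X_k] is invertible, the residual
   vanishes; if [X_k u = 0] with [u <> 0], the other blocks can be moved along
   [u] at constant cost, and criticality along this motion forces
   [X_k X_j^T = M*_kj], which contradicts that [M*_kj] is invertible. *)
Require Import Defs.
From mathcomp Require Import all_boot all_order all_algebra.
From mathcomp Require Import all_classical all_reals all_analysis.
From mathcomp Require Import ring lra zify.

Set Implicit Arguments.
Unset Strict Implicit.
Unset Printing Implicit Defensive.

Import Order.TTheory GRing.Theory Num.Theory.
Import numFieldNormedType.Exports.

Local Open Scope classical_set_scope.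
Local Open Scope ring_scope.

(** * Compactness and continuity on matrix spaces *)

(** [vec_mx] carries a product of segments onto the box; it is continuous because it only relabels
    coordinates and balls are entrywise. *)
Lemma mx_box_compact (R : realType) m n (c : R) :
  compact [set X : 'M[R]_(m, n) | forall i j, `|X i j| <= c].
Proof.
have -> : [set X : 'M[R]_(m, n) | forall i j, `|X i j| <= c] =
    vec_mx @` [set v : 'rV[R]_(m * n) | forall k, `[- c, c]%classic (v ord0 k)].
  apply/seteqP; split=> [X Xc|_ [v vc <-] i j].
    exists (mxvec X); last exact: mxvecK.
    by move=> k; case/mxvec_indexP: k => i j; rewrite mxvecE /= in_itv /= -ler_norml.
  by rewrite mxE ler_norml; have := vc (mxvec_index i j); rewrite /= in_itv.
apply: continuous_compact; last first.
  by apply: (@rV_compact _ _ (fun=> `[- c, c]%classic)) => _; exact: segment_compact.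
apply: continuous_subspaceT => v A /nbhs_ballP[e e0 eA].
apply/nbhs_ballP; exists e => // w [_ vw]; apply: eA; split=> // i j.
by rewrite !mxE; exact: vw.
Qed.

Lemma gram_entry_continuous (R : realType) m n (p q : 'I_m) :
  continuous (fun X : 'M[R]_(m, n) => (X *m X^T) p q).
Proof.
have -> : (fun X : 'M[R]_(m, n) => (X *m X^T) p q) =
    (fun X => \sum_c X p c * X q c).
  by apply/funext => X; rewrite mxE; apply: eq_bigr => c _; rewrite mxE.
apply: (continuous_big (@add_continuous R)) => c _ X.
exact: (cvgM (@coord_continuous R m n p c X) (@coord_continuous R m n q c X)).
Qed.

Lemma objectiveE (R : realType) n r (P : problem R n r) (X : 'M[R]_(n, r)) :
  objective P X = \sum_p \sum_q
    (if (p, q) \in measured P then ((X *m X^T) p q - truth P p q) ^+ 2 else 0).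
Proof.
rewrite /objective /frobenius sqr_sqrtr; last first.
  by apply: sumr_ge0 => p _; apply: sumr_ge0 => q _; exact: sqr_ge0.
apply: eq_bigr => p _; apply: eq_bigr => q _; rewrite !mxE.
by case: ifP => // _; rewrite expr0n.
Qed.

Lemma objective_ge0 (R : realType) n r (P : problem R n r) X : 0 <= objective P X.
Proof. by rewrite /objective sqr_ge0. Qed.

Lemma objective_continuous (R : realType) n r (P : problem R n r) :
  continuous (objective P).
Proof.
have -> : objective P = (fun X => \sum_p \sum_q
    (if (p, q) \in measured P then ((X *m X^T) p q - truth P p q) ^+ 2 else 0)).
  by apply/funext => X; rewrite objectiveE.
apply: (continuous_big (@add_continuous R)) => p _.
apply: (continuous_big (@add_continuous R)) => q _.
case: ((p, q) \in _) => X; last exact: cst_continuous.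
have h : (X *m X^T) p q - truth P p q @[X --> X] --> (X *m X^T) p q - truth P p q.
  exact: (cvgD (@gram_entry_continuous R n r p q X) (cvg_cst _)).
exact: (cvgM h h).
Qed.

(** * First-order criticality of local minima *)

Lemma line_cvg (R : realType) n r (X Z : 'M[R]_(n, r)) :
  X + t *: Z @[t --> (0 : R)] --> X.
Proof.
have := cvgD (cvg_cst X) (@scalel_continuous R _ Z 0).
by rewrite scale0r addr0; exact.
Qed.

(** For small [t] the linear term dominates, so a nonzero [b] would make the polynomial negative at
    [t] or at [- t]. *)
Lemma linear_term_eq0 (R : realType) (b C : R) :
  (\forall t \near (0 : R), 0 <= b * t + C * t ^+ 2) -> b = 0.
Proof.
move=> /nbhs_ballP[e /= e0 eP].
have pos t : `|t| < e -> 0 <= b * t + C * t ^+ 2.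
  by move=> te; apply: eP; rewrite /ball /= sub0r normrN.
pose K := `|C| + 1; have K0 : 0 < K by rewrite /K; have := normr_ge0 C; lra.
have CK : C < K by rewrite /K; have := ler_norm C; lra.
apply/eqP/negPn/negP => b0; have nb0 : 0 < `|b| by rewrite normr_gt0.
(* This choice stays in the ball and gives [C t^2 < K t^2 <= |b| t]. *)
pose t := Num.min (e / 2) (`|b| / K).
have t0 : 0 < t by rewrite lt_min !divr_gt0.
have te : t < e by rewrite /t gt_min; apply/orP; left; lra.
have tK : t * K <= `|b| by rewrite -ler_pdivlMr // /t ge_min lexx orbT.
have := pos t; have := pos (- t); rewrite normrN (gtr0_norm t0).
move=> /(_ te) ht' /(_ te) ht.
have tKC : 0 < t * t * (K - C) by rewrite mulr_gt0 ?mulr_gt0 // subr_gt0.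
have tbK : 0 <= t * (`|b| - t * K) by rewrite mulr_ge0 ?(ltW t0) // subr_ge0.
move: tKC tbK ht ht'; clearbody t K; clear.
by case: (ger0P b) => _ tKC tbK ht ht'; nra.
Qed.

Lemma trmx_restrict (R : realType) n (Omega : {set 'I_n * 'I_n}) (M : 'M[R]_n) :
  (forall p q, ((p, q) \in Omega) = ((q, p) \in Omega)) ->
  (Defs.restrict Omega M)^T = Defs.restrict Omega M^T.
Proof. by move=> symO; apply/matrixP => p q; rewrite !mxE symO. Qed.

Lemma mxtrace_mul_trE (R : realType) n r (A B : 'M[R]_(n, r)) :
  \tr (A *m B^T) = \sum_p \sum_c A p c * B p c.
Proof.
by apply: eq_bigr => p _; rewrite mxE; apply: eq_bigr => c _; rewrite mxE.
Qed.

Lemma mxtrace_mul_tr_eq0 (R : realType) n r (A : 'M[R]_(n, r)) :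
  \tr (A *m A^T) = 0 -> A = 0.
Proof.
rewrite mxtrace_mul_trE => A0; apply/matrixP => p c; rewrite mxE; apply/eqP.
have pos q d : 0 <= A q d * A q d by rewrite -expr2 sqr_ge0.
have /(_ p isT) Ap0 := psumr_eq0P (fun q _ => sumr_ge0 _ (fun d _ => pos q d)) A0.
have /(_ c isT) /eqP := psumr_eq0P (fun d _ => pos p d) Ap0.
by rewrite mulf_eq0 orbb.
Qed.

(** The masked residual times [X] is the gradient up to a factor. Moving along [Z := G *m X] itself
    makes the linear coefficient equal to [4 \tr (Z *m Z^T)], so its vanishing kills [Z]. *)
Lemma local_min_critical (R : realType) n r (P : problem R n r) X :
  (truth P)^T = truth P ->
  (forall p q, ((p, q) \in measured P) = ((q, p) \in measured P)) ->
  local_min (objective P) X ->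
  Defs.restrict (measured P) (X *m X^T - truth P) *m X = 0.
Proof.
move=> symM symO minX; set D := X *m X^T - truth P.
set G := Defs.restrict _ D; set Z := G *m X; set S := X *m Z^T + Z *m X^T.
have GT : G^T = G.
  by rewrite trmx_restrict // linearB /= trmx_mul trmxK symM.
apply: mxtrace_mul_tr_eq0; rewrite -/Z.
(* The entrywise coefficient [2 s^2 + 3 u^2 + d^2] dominates all terms of order at least two in [t]
   when [|t| <= 1], so the quartic is bounded by a quadratic; the sum of squares below certifies
   this. *)
pose C := \sum_p \sum_q (S p q ^+ 2 *+ 2 + (Z *m Z^T) p q ^+ 2 *+ 3 + G p q ^+ 2).
have: \tr (G *m S^T) *+ 2 = 0.
  apply: (@linear_term_eq0 _ _ C); near=> t.
  have t1 : `|t| <= 1 by near: t; apply: cvgr0_norm_le; [exact: cvg_id|exact: ltr01].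
  have : objective P X <= objective P (X + t *: Z).
    by near: t; exact: (@line_cvg R n r X Z _ minX).
  rewrite -subr_ge0 => /le_trans; apply.
  rewrite !objectiveE mxtrace_mul_trE /C lerBlDr.
  rewrite -sumrMnl !mulr_suml -!big_split /=; apply: ler_sum => p _.
  rewrite -sumrMnl !mulr_suml -!big_split /=; apply: ler_sum => q _.
  have -> : ((X + t *: Z) *m (X + t *: Z)^T) p q - truth P p q =
      D p q + t * S p q + t ^+ 2 * (Z *m Z^T) p q.
    rewrite linearD /= linearZ /= mulmxDl !mulmxDr -!scalemxAl -!scalemxAr scalerA.
    rewrite /D /S !mxE; ring.
  have -> : (X *m X^T) p q - truth P p q = D p q by rewrite !mxE.
  have -> : G p q = if (p, q) \in measured P then D p q else 0 by rewrite mxE.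
  move: (D p q) (S p q) ((Z *m Z^T) p q) => d s u.
  have t2 : 0 <= 1 - t ^+ 2 by rewrite subr_ge0 -real_normK ?num_real // expr_le1.
  have t20 := sqr_ge0 t.
  case: ifP => _.
    rewrite -subr_ge0.
    have -> : d * s *+ 2 * t + (s ^+ 2 *+ 2 + u ^+ 2 *+ 3 + d ^+ 2) * t ^+ 2 + d ^+ 2
      - (d + t * s + t ^+ 2 * u) ^+ 2 =
      t ^+ 2 * ((s - t * u) ^+ 2 + (d - u) ^+ 2 + (1 - t ^+ 2) * u ^+ 2 *+ 2)
      by ring.
    by apply: mulr_ge0 => //; rewrite !addr_ge0 ?sqr_ge0 //; rewrite mulr_ge0 ?sqr_ge0.
  rewrite mul0r mul0rn mul0r !(addr0, add0r) expr0n /= addr0 mulr_ge0 //.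
  by rewrite !addr_ge0 ?sqr_ge0.
have trS (W : 'M[R]_(n, r)) :
    \tr (G *m (X *m W^T + W *m X^T)^T) = \tr (G *m X *m W^T) *+ 2.
  rewrite linearD /= !trmx_mul !trmxK mulmxDr linearD /= !mulmxA.
  rewrite -[X in X + _]mxtrace_tr !trmx_mul trmxK GT mulmxA.
  by rewrite [X in X + _]mxtrace_mulC mulmxA mulr2n.
rewrite trS -/Z.
by move/eqP; rewrite -mulrnA mulrn_eq0 => /eqP.
Unshelve. all: by end_near. Qed.

(** * Block calculus and measured entries *)

Definition blockrow (R : realType) m r n (X : 'M[R]_(m * r, n)) (i : 'I_m)
    : 'M[R]_(r, n) :=
  \matrix_(a, c) X (mxvec_index i a) c.

Lemma sum_mxvec_index (R : nmodType) m r (F : 'I_(m * r) -> R) :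
  \sum_p F p = \sum_i \sum_a F (mxvec_index i a).
Proof.
rewrite pair_bigA /= (reindex (uncurry (@mxvec_index m r))) /=.
  by apply: eq_bigr => -[].
exact: curry_mxvec_bij.
Qed.

Lemma mxvec_index_inj m r (i j : 'I_m) (a b : 'I_r) :
  (mxvec_index i a == mxvec_index j b) = (i == j) && (a == b).
Proof.
apply/eqP/andP => [/cast_ord_inj/enum_rank_inj[-> ->] //|].
by case=> /eqP -> /eqP ->.
Qed.

Lemma entry_inj m r (e e' : 'I_m * 'I_m) (s s' : 'I_r * 'I_r) :
  entry e s = entry e' s' -> e = e' /\ s = s'.
Proof.
case: e s e' s' => [i j] [a b] [i' j'] [a' b'].
move=> /eqP; rewrite xpair_eqE /= !mxvec_index_inj.
by move=> /andP[/andP[/eqP-> /eqP->] /andP[/eqP-> /eqP->]].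
Qed.

Lemma mem_all_entries m r (E : {set 'I_m * 'I_m}) i j (a b : 'I_r) :
  ((mxvec_index i a, mxvec_index j b) \in all_entries r E) = ((i, j) \in E).
Proof.
apply/imset2P/idP => [[e s eE _ /(@entry_inj _ _ (i, j) _ (a, b))[-> //]]|ijE].
by exists (i, j) (a, b); rewrite ?inE.
Qed.

Lemma mem_nondiagonal_entries m r (E : {set 'I_m * 'I_m}) i j (a b : 'I_r) :
  ((mxvec_index i a, mxvec_index j b) \in nondiagonal_entries r E) =
  ((i, j) \in E) && (a != b).
Proof.
apply/imset2P/andP => [[e s eE]|[ijE ab]].
  by rewrite inE => sab /(@entry_inj _ _ (i, j) _ (a, b))[-> ss]; rewrite -ss in sab.
by exists (i, j) (a, b); rewrite ?inE.
Qed.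

Lemma mem_Omega_star m r (k i j : 'I_m) (a b : 'I_r) :
  ((mxvec_index i a, mxvec_index j b) \in Omega_star r k) = (i == k) || (j == k).
Proof. by rewrite mem_all_entries inE. Qed.

(** The complement is what matters later: only diagonal entries of off-diagonal blocks avoiding [k]
    are unmeasured, and their signs are thus left free. *)
Lemma mem_Omega_tilde m r (k i j : 'I_m) (a b : 'I_r) :
  ((mxvec_index i a, mxvec_index j b) \in Omega_tilde r k) =
  [|| i == k, j == k, i == j | a != b].
Proof.
rewrite finset.in_setU mem_all_entries mem_nondiagonal_entries !inE /=.
by case: (i == k); case: (j == k); case: (i == j); case: (a == b).
Qed.

Lemma block_sub (R : realType) m r (A B : 'M[R]_(m * r)) i j :
  block (A - B) i j = block A i j - block B i j.
Proof. by apply/matrixP => a b; rewrite !mxE. Qed.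

Lemma block_mul_tr (R : realType) m r n (X Y : 'M[R]_(m * r, n)) i j :
  block (X *m Y^T) i j = blockrow X i *m (blockrow Y j)^T.
Proof.
apply/matrixP => a b; rewrite !mxE.
by apply: eq_bigr => c _; rewrite !mxE.
Qed.

Lemma blockrow_mul (R : realType) m r n (A : 'M[R]_(m * r)) (X : 'M[R]_(m * r, n)) i :
  blockrow (A *m X) i = \sum_j block A i j *m blockrow X j.
Proof.
apply/matrixP => a c; rewrite summxE !mxE sum_mxvec_index.
by apply: eq_bigr => j _; rewrite !mxE; apply: eq_bigr => b _; rewrite !mxE.
Qed.

Lemma blockrowD (R : realType) m r n (X Y : 'M[R]_(m * r, n)) i :
  blockrow (X + Y) i = blockrow X i + blockrow Y i.
Proof. by apply/matrixP => a c; rewrite !mxE. Qed.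

Lemma blockrowZ (R : realType) m r n t (X : 'M[R]_(m * r, n)) i :
  blockrow (t *: X) i = t *: blockrow X i.
Proof. by apply/matrixP => a c; rewrite !mxE. Qed.

Lemma block_inj (R : realType) m r (A B : 'M[R]_(m * r)) :
  (forall i j, block A i j = block B i j) -> A = B.
Proof.
move=> AB; apply/matrixP => p q.
case/mxvec_indexP: p => i a; case/mxvec_indexP: q => j b.
by have /matrixP/(_ a b) := AB i j; rewrite !mxE.
Qed.

Lemma block_restrict_star (R : realType) m r (k i j : 'I_m) (A : 'M[R]_(m * r)) :
  block (Defs.restrict (Omega_star r k) A) i j =
  if (i == k) || (j == k) then block A i j else 0.
Proof.
by apply/matrixP => a b; rewrite !mxE mem_Omega_star; case: ifP => _; rewrite mxE.
Qed.

(** * Absence of spurious minima for the star *)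

Lemma not_spurious_of_eq0 (R : realType) n r (P : problem R n r) X :
  objective P X = 0 -> ~ spurious (objective P) X.
Proof.
move=> X0 [_]; rewrite X0 ltNge => /negP; apply.
apply: lb_le_inf; first by exists (objective P X), X.
by move=> _ [Y _ <-]; exact: objective_ge0.
Qed.

Lemma local_min_star_eq0 (R : realType) m r (k : 'I_m) (M : 'M[R]_(m * r)) X :
  M^T = M -> (exists2 j, j != k & block M k j \in unitmx) ->
  local_min (objective (Problem r M (Omega_star r k))) X ->
  objective (Problem r M (Omega_star r k)) X = 0.
Proof.
move=> symM [j0 j0k unitMkj] minX; set f := objective _ in minX *.
have symO p q : ((p, q) \in Omega_star r k) = ((q, p) \in Omega_star r k).
  case/mxvec_indexP: p => i a; case/mxvec_indexP: q => j b.
  by rewrite !mem_Omega_star orbC.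
pose G (Y : 'M[R]_(m * r, r)) := Defs.restrict (Omega_star r k) (Y *m Y^T - M).
have critical Y : local_min f Y -> G Y *m Y = 0 by exact: local_min_critical.
have blockG Y i j : block (G Y) i j = if (i == k) || (j == k)
    then blockrow Y i *m (blockrow Y j)^T - block M i j else 0.
  by rewrite block_restrict_star block_sub block_mul_tr.
have unitXk : blockrow X k \in unitmx.
  apply/negPn/negP => sing.
  have [u u0 uX] : exists2 u : 'rV[R]_r, u != 0 & u *m (blockrow X k)^T = 0.
    have : kermx (blockrow X k)^T != 0.
      by rewrite kermx_eq0 row_free_unit unitmx_tr.
    move=> /rowV0Pn[u /sub_kermxP uX u0]; by exists u.
  have Xu : blockrow X k *m u^T = 0 by rewrite -[LHS]trmxK trmx_mul trmxK uX trmx0.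
  (* A vanishing residual here would make [M_kj0 = X_k X_j0^T] singular. *)
  suff Xk0 : block (G X) k j0 = 0.
    move: Xk0; rewrite blockG eqxx /= => /eqP; rewrite subr_eq0 => /eqP XM.
    by move: unitMkj; rewrite -XM unitmx_mul (negPf sing).
  apply/matrixP => a b; rewrite mxE.
  (* As [X_k u^T = 0], adding multiples of [W] changes no measured entry, so it
     turns [X] into nearby local minima. *)
  pose W : 'M[R]_(m * r, r) := delta_mx (mxvec_index j0 b) (ord0 : 'I_1) *m u.
  have Wk : blockrow W k = 0.
    apply/matrixP => a' c; rewrite !mxE big_ord1 !mxE.
    by rewrite mxvec_index_inj eq_sym (negPf j0k) mul0r.
  have WX i : blockrow X k *m (blockrow W i)^T = 0.
    have -> : blockrow W i = blockrow (delta_mx (mxvec_index j0 b) (ord0 : 'I_1)) i *m u.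
      by apply/matrixP => a' c; rewrite !mxE; apply: eq_bigr => d _; rewrite !mxE.
    by rewrite trmx_mul mulmxA Xu mul0mx.
  have GW t : G (X + t *: W) = G X.
    apply: block_inj => i j; rewrite !blockG.
    case: ifP => // /orP[|] /eqP ->; rewrite !blockrowD !blockrowZ Wk scaler0 addr0.
      by rewrite linearD linearZ /= mulmxDr -scalemxAr WX scaler0 addr0.
    rewrite mulmxDl -scalemxAl -[blockrow W i *m _]trmxK trmx_mul trmxK WX trmx0.
    by rewrite scaler0 addr0.
  have fW t : f (X + t *: W) = f X.
    by rewrite /f /objective -/(G _) GW.
  (* By [near_join], [f X] is a lower bound around every point close to [X]; as [f] is constant
     along the line, nearby points of it are local minima too. *)
  have minW : \forall t \near (0 : R), local_min f (X + t *: W).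
    have near0 : \forall t \near (0 : R), \forall Y \near X + t *: W, f X <= f Y.
      exact: (@line_cvg R _ _ X W _ (near_join minX)).
    by apply: filterS near0 => t; apply: filterS => Y; rewrite fW.
  have [t [t0 minWt]] : exists t : R, t != 0 /\ local_min f (X + t *: W).
    have [e /= e0 eP] := (nbhs_ballP _ _).1 minW.
    exists (e / 2); split; first by rewrite gt_eqF // divr_gt0.
    by apply: eP; rewrite /ball /= sub0r normrN gtr0_norm ?divr_gt0 //; lra.
  (* The critical equations at [X] and at [X + t *: W] share the residual; their difference gives
     [G X *m W = 0], that is, column [(j0, b)] of the residual times [u] vanishes. *)
  have := critical _ minWt; rewrite GW mulmxDr (critical _ minX) add0r -scalemxAr.
  move=> /eqP; rewrite scaler_eq0 (negPf t0) /= mulmxA => /eqP GWu.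
  have [c uc] : exists c, u ord0 c != 0.
    by apply/rV0Pn.
  have /matrixP/(_ (mxvec_index k a) c) := GWu.
  rewrite !mxE big_ord1 -colE mxE => /eqP.
  by rewrite mulf_eq0 (negPf uc) orbF => /eqP; rewrite !mxE.
suff G0 : G X = 0.
  rewrite /f /objective -/(G _) G0 /frobenius big1 ?sqrtr0 ?expr0n // => p _.
  by rewrite big1 // => q _; rewrite mxE expr0n.
have blockrow0 i : \sum_j block (G X) i j *m blockrow X j = 0.
  by rewrite -blockrow_mul critical //; apply/matrixP => a c; rewrite !mxE.
(* With [X_k] invertible, block row [i != k] of [G X *m X = 0] retains only the term [j = k].
   Symmetry then clears row [k] up to its diagonal block, which row [k] of the equation clears. *)
have Gjk i : i != k -> block (G X) i k = 0.
  move=> ik; have := blockrow0 i; rewrite (bigD1 k) //= big1 ?addr0.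
    by move=> GX; rewrite -[LHS](mulmxK unitXk) GX mul0mx.
  by move=> j jk; rewrite blockG (negPf ik) (negPf jk) mul0mx.
have GT : (G X)^T = G X.
  by rewrite trmx_restrict // linearB /= trmx_mul trmxK symM.
have Gkj j : j != k -> block (G X) k j = 0.
  move=> jk; rewrite -GT; apply/matrixP => a b.
  by have /matrixP/(_ b a) := Gjk j jk; rewrite !mxE.
have Gkk : block (G X) k k = 0.
  have := blockrow0 k; rewrite (bigD1 k) //= big1 ?addr0.
    by move=> GX; rewrite -[LHS](mulmxK unitXk) GX mul0mx.
  by move=> j jk; rewrite Gkj // mul0mx.
apply: block_inj => i j.
have -> : block (0 : 'M[R]_(m * r)) i j = 0 by apply/matrixP => a b; rewrite !mxE.
have [->|ik] := eqVneq i k; first by have [->|/Gkj] := eqVneq j k.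
have [->|jk] := eqVneq j k; first exact: Gjk.
by rewrite blockG (negPf ik) (negPf jk).
Qed.

(** * The ground truth and membership in the class *)

Definition stack (R : realType) m r n (F : 'I_m -> 'M[R]_(r, n)) : 'M[R]_(m * r, n) :=
  \matrix_(p, c) mxvec (\matrix_(i, a) F i a c) ord0 p.

Lemma blockrow_stack (R : realType) m r n (F : 'I_m -> 'M[R]_(r, n)) i :
  blockrow (stack F) i = F i.
Proof. by apply/matrixP => a c; rewrite !mxE mxvecE mxE. Qed.

Definition weight (R : realType) m (k : 'I_m) (eps : R) (i : 'I_m) : R :=
  if i == k then eps else 1.

Definition ground_truth (R : realType) m r (k : 'I_m) (eps : R) : 'M[R]_(m * r) :=
  let W := stack (fun i => (weight k eps i)%:M : 'M[R]_r) in W *m W^T.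

Lemma block_ground_truth (R : realType) m r (k : 'I_m) (eps : R) i j :
  block (ground_truth r k eps) i j = (weight k eps i * weight k eps j)%:M.
Proof. by rewrite block_mul_tr !blockrow_stack tr_scalar_mx -scalar_mxM. Qed.

Lemma psd_gram (R : realType) n r (X : 'M[R]_(n, r)) : psd (X *m X^T).
Proof.
split=> [|x]; first by rewrite trmx_mul trmxK.
have -> : x^T *m (X *m X^T) *m x = (x^T *m X) *m (x^T *m X)^T.
  by rewrite trmx_mul trmxK !mulmxA.
by rewrite mxE sumr_ge0 // => c _; rewrite [X in _ * X]mxE -expr2 sqr_ge0.
Qed.

Lemma mxrank_block (R : realType) m r (M : 'M[R]_(m * r)) i j :
  (\rank (block M i j) <= \rank M)%N.
Proof.
have -> : block M i j = rowsub (mxvec_index i) (colsub (mxvec_index j) M).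
  by apply/matrixP => a b; rewrite !mxE.
rewrite rowsubE -[M in colsub _ M]mulmx1 -mulmx_colsub.
exact: leq_trans (mxrankM_maxr _ _) (mxrankM_maxl _ _).
Qed.

Lemma mxrank_block_ground_truth (R : realType) m r (k : 'I_m) (eps : R) i j :
  0 < eps -> \rank (block (ground_truth r k eps) i j) = r.
Proof.
move=> eps0; rewrite block_ground_truth mxrank_unit //.
have w0 l : weight k eps l != 0.
  by rewrite /weight; case: ifP => _; rewrite ?oner_eq0 // gt_eqF.
by rewrite -scalemx1 unitmxZ ?unitmx1 // unitfE mulf_neq0.
Qed.

(** The factorization bounds the rank from above, a single block from below. *)
Lemma mxrank_ground_truth (R : realType) m r (k : 'I_m) (eps : R) :
  0 < eps -> \rank (ground_truth r k eps) = r.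
Proof.
move=> eps0; apply/eqP; rewrite eqn_leq.
rewrite (leq_trans (mxrankM_maxl _ _) (rank_leq_col _)) /=.
by rewrite -{1}(mxrank_block_ground_truth r k k k eps0) mxrank_block.
Qed.

(** Every vertex is adjacent to [k], which gives connectedness, and the loop at [k] excludes a
    two-colouring. *)
Lemma star_class_L (R : realType) m r (k : 'I_m) (M : 'M[R]_(m * r)) :
  psd M -> \rank M = r -> (forall i j, \rank (block M i j) = r) ->
  class_L (star_graph k) (Problem r M (Omega_tilde r k)).
Proof.
move=> psdM rankM rankB; split=> //; split.
  move=> i j; apply: (@connect_trans _ _ k); apply: connect1; rewrite /= !inE /=.
    by rewrite eqxx orbT.
  by rewrite eqxx.
by move=> [c] /(_ k k); rewrite !inE /= !eqxx => /(_ isT).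
Qed.

(** * Consequences of a small objective value *)

Lemma le_sum_term (R : realType) (I : finType) (F : I -> R) i :
  (forall j, 0 <= F j) -> F i <= \sum_j F j.
Proof.
by move=> F0; rewrite (bigD1 i) //= lerDl sumr_ge0.
Qed.

Lemma objective_tildeE (R : realType) m r (k : 'I_m) (M : 'M[R]_(m * r)) X :
  objective (Problem r M (Omega_tilde r k)) X =
  \sum_i \sum_j \sum_a \sum_b (if [|| i == k, j == k, i == j | a != b]
    then ((blockrow X i *m (blockrow X j)^T) a b - block M i j a b) ^+ 2 else 0).
Proof.
rewrite objectiveE sum_mxvec_index; apply: eq_bigr => i _.
under eq_bigr => a _ do rewrite sum_mxvec_index.
rewrite exchange_big; apply: eq_bigr => j _; apply: eq_bigr => a _.
apply: eq_bigr => b _; rewrite mem_Omega_tilde -block_mul_tr.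
by case: ifP => // _; rewrite !mxE.
Qed.

Lemma block_objective_le (R : realType) m r (k : 'I_m) (M : 'M[R]_(m * r)) X i j :
  \sum_a \sum_b (if [|| i == k, j == k, i == j | a != b]
    then ((blockrow X i *m (blockrow X j)^T) a b - block M i j a b) ^+ 2 else 0) <=
  objective (Problem r M (Omega_tilde r k)) X.
Proof.
rewrite objective_tildeE.
pose F i j a b := if [|| i == k, j == k, i == j | a != b]
    then ((blockrow X i *m (blockrow X j)^T) a b - block M i j a b) ^+ 2 else 0.
have F0 i' j' a b : 0 <= F i' j' a b by rewrite /F; case: ifP => // _; exact: sqr_ge0.
have F1 i' j' : 0 <= \sum_a \sum_b F i' j' a b.
  by apply: sumr_ge0 => a _; apply: sumr_ge0.
apply: (le_trans (le_sum_term j (F1 i))).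
apply: (@le_sum_term _ _ (fun i => \sum_j \sum_a \sum_b F i j a b)) => i'.
exact: sumr_ge0.
Qed.

Lemma entry_objective_le (R : realType) m r (k : 'I_m) (M : 'M[R]_(m * r)) X i j a b :
  [|| i == k, j == k, i == j | a != b] ->
  ((blockrow X i *m (blockrow X j)^T) a b - block M i j a b) ^+ 2 <=
  objective (Problem r M (Omega_tilde r k)) X.
Proof.
move=> ijab; apply: le_trans (block_objective_le k M X i j).
pose F a b := if [|| i == k, j == k, i == j | a != b]
    then ((blockrow X i *m (blockrow X j)^T) a b - block M i j a b) ^+ 2 else 0.
have F0 a' b' : 0 <= F a' b' by rewrite /F; case: ifP => // _; exact: sqr_ge0.
have -> : ((blockrow X i *m (blockrow X j)^T) a b - block M i j a b) ^+ 2 = F a b.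
  by rewrite /F ijab.
apply: (le_trans (le_sum_term b (F0 a))).
by apply: (@le_sum_term _ _ (fun a => \sum_b F a b)) => a'; apply: sumr_ge0.
Qed.

(* If the rows of [G] are nearly orthonormal then so are its columns, since
   [G G^T - 1] and [G^T G - 1] have the same Frobenius norm; hence
   [|G v|] is close to [|v|]. *)
Lemma aligned_of_near_orthonormal (R : realType) r (G : 'M[R]_r) (v : 'rV[R]_r) a :
  \sum_b \sum_c ((G *m G^T) b c - (b == c)%:R) ^+ 2 <= 1 / 100 ->
  ((v *m v^T) 0 0 - 1) ^+ 2 <= 1 / 100 ->
  \sum_(b | b != a) (G *m v^T) b 0 ^+ 2 <= 1 / 100 ->
  1 / 4 < (G *m v^T) a 0 ^+ 2.
Proof.
move=> GG vv Gv; set N := (v *m v^T) 0 0 in vv.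
pose E := G^T *m G - 1%:M; have ET : E^T = E.
  by rewrite /E linearB /= trmx_mul trmxK trmx1.
have trE : \tr (E *m E^T) <= 1 / 100.
  have -> : \tr (E *m E^T) = \tr ((G *m G^T - 1%:M) *m (G *m G^T - 1%:M)^T).
    rewrite ET /E [(G *m G^T - 1%:M)^T]linearB /= trmx_mul trmxK trmx1.
    have tr_sqr (A : 'M[R]_r) : \tr ((A - 1%:M) *m (A - 1%:M)) =
        \tr (A *m A) - \tr A *+ 2 + \tr (1%:M : 'M[R]_r).
      rewrite mulmxBl mulmxBr mulmx1 mul1mx !raddfB /=; ring.
    rewrite !tr_sqr -mulmxA [\tr (G^T *m _)]mxtrace_mulC !mulmxA.
    by rewrite [\tr (G^T *m G)]mxtrace_mulC.
  rewrite mxtrace_mul_trE; apply: le_trans GG; apply: ler_sum => b _.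
  by apply: ler_sum => c _; rewrite !mxE -expr2.
(* Cauchy-Schwarz without square roots: expanding [|E + (1/10) v^T v|^2 >= 0] bounds [v E v^T] from
   below. The weight 1/10 matches [|E| <= 1/10] and [|v|] near 1. *)
have cauchy : 0 <= \tr (E *m E^T) + 2 / 10 * (v *m E *m v^T) 0 0 + 1 / 100 * N ^+ 2.
  have : 0 <= \tr ((E + (1 / 10) *: (v^T *m v)) *m (E + (1 / 10) *: (v^T *m v))^T).
    rewrite mxtrace_mul_trE; apply: sumr_ge0 => b _; apply: sumr_ge0 => c _.
    by rewrite -expr2 sqr_ge0.
  have tr1 (A : 'M[R]_1) : \tr A = A 0 0 by rewrite /mxtrace big_ord1.
  have Evv : \tr (E *m (v^T *m v)) = (v *m E *m v^T) 0 0.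
    by rewrite mulmxA mxtrace_mulC mulmxA tr1.
  have vvvv : \tr (v^T *m v *m (v^T *m v)) = N ^+ 2.
    by rewrite mulmxA mxtrace_mulC !mulmxA tr1 -mulmxA mxE big_ord1 -/N expr2.
  have expand (A B : 'M[R]_r) (t : R) : B^T = B ->
      \tr ((A + t *: B) *m (A + t *: B)^T) =
      \tr (A *m A^T) + t *+ 2 * \tr (A *m B) + t ^+ 2 * \tr (B *m B).
    move=> BT; rewrite linearD linearZ /= BT mulmxDl !mulmxDr -!scalemxAl -!scalemxAr.
    rewrite !mxtraceD !mxtraceZ -[\tr (B *m A^T)]mxtrace_tr trmx_mul trmxK BT; ring.
  rewrite expand ?trmx_mul ?trmxK // Evv vvvv => h.
  by apply: (le_trans h); lra.
have normGv : (v *m E *m v^T) 0 0 = \sum_b (G *m v^T) b 0 ^+ 2 - N.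
  rewrite /E mulmxBr mulmx1 mulmxBl mxE [X in _ + X]mxE -/N; congr (_ - _).
  rewrite !mulmxA -mulmxA -[v *m G^T]trmxK trmx_mul trmxK mxE.
  by apply: eq_bigr => b _; rewrite mxE expr2.
move: cauchy; rewrite normGv (bigD1 a) //=; clear normGv; clearbody N.
move: trE Gv vv; set S := \sum_(b | _) _.
move: (\tr _) S ((G *m v^T) a 0 ^+ 2) => e S c he hS hN h.
(* Now [c >= N - S - 5 e - N^2 / 20], which for [N] within 1/10 of 1 is well above 1/4. *)
have N1 : 9 / 10 <= N by nra.
have N2 : N <= 11 / 10 by nra.
nra.
Qed.

(** These inner products are unchanged by [X -> X Q] with [Q] orthogonal, so their signs can label
    equivalence classes. *)
Definition alignment (R : realType) m r (j0 : 'I_m) (X : 'M[R]_(m * r, r))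
    (j : 'I_m) (a : 'I_r) : R :=
  (blockrow X j0 *m (blockrow X j)^T) a a.

Lemma alignment_continuous (R : realType) m r (j0 j : 'I_m) (a : 'I_r) :
  continuous (fun X : 'M[R]_(m * r, r) => alignment j0 X j a).
Proof.
have -> : (fun X : 'M[R]_(m * r, r) => alignment j0 X j a) =
    (fun X => (X *m X^T) (mxvec_index j0 a) (mxvec_index j a)).
  apply/funext => X; have /matrixP/(_ a a) := block_mul_tr X X j0 j.
  by rewrite /alignment !mxE => <-.
exact: gram_entry_continuous.
Qed.

(** Measured entries make the rows of [X_j0] nearly orthonormal, row [a] of [X_j] nearly a unit
    vector, and that row nearly orthogonal to the other rows of [X_j0]. The resulting gap around 0
    separates the sign patterns within the sublevel set. *)
Lemma alignment_sqr_gt (R : realType) m r (k j0 j : 'I_m) (eps : R) X (a : 'I_r) :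
  j0 != k -> j != k ->
  objective (Problem r (ground_truth r k eps) (Omega_tilde r k)) X <= 1 / 100 ->
  1 / 4 < alignment j0 X j a ^+ 2.
Proof.
move=> j0k jk fX; set M := ground_truth r k eps in fX.
have blockM i l : i != k -> l != k -> block M i l = 1%:M.
  by move=> ik lk; rewrite block_ground_truth /weight (negPf ik) (negPf lk) mulr1.
have -> : alignment j0 X j a = (blockrow X j0 *m (row a (blockrow X j))^T) a 0.
  by rewrite /alignment !mxE; apply: eq_bigr => c _; rewrite !mxE.
apply: aligned_of_near_orthonormal.
- apply: le_trans fX; apply: le_trans (block_objective_le k M X j0 j0).
  apply: ler_sum => b _; apply: ler_sum => c _.
  by rewrite eqxx !orbT blockM // [1%:M b c]mxE.
- have := @entry_objective_le R m r k M X j j a a.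
  rewrite eqxx !orbT blockM // => /(_ isT) /le_trans /(_ fX).
  rewrite [1%:M a a]mxE eqxx; congr (_ <= _); congr ((_ - _) ^+ 2).
  by rewrite -row_mul tr_row !mxE; apply: eq_bigr => c _; rewrite !mxE.
- apply: le_trans fX; apply: le_trans (block_objective_le k M X j0 j).
  rewrite big_mkcond /=; apply: ler_sum => b _; case: eqP => [ba|/eqP ba] /=.
    by apply: sumr_ge0 => c _; case: ifP => // _; rewrite sqr_ge0.
  pose F c := if [|| j0 == k, j == k, j0 == j | b != c] then
    ((blockrow X j0 *m (blockrow X j)^T) b c - block M j0 j b c) ^+ 2 else 0.
  apply: le_trans (@le_sum_term _ _ F a _); last first.
    by move=> c; rewrite /F; case: ifP => // _; exact: sqr_ge0.
  rewrite /F ba !orbT blockM // [1%:M b a]mxE (negPf ba) subr0.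
  rewrite le_eqVlt; apply/orP; left; apply/eqP; congr (_ ^+ 2).
  by rewrite !mxE; apply: eq_bigr => c _; rewrite !mxE.
Qed.

(** Squared row norms are measured and lie within 1/10 of a number at most 1. The strict bound keeps
    the sublevel set inside the open box. *)
Lemma entry_lt2 (R : realType) m r (k : 'I_m) (eps : R) X p c :
  0 < eps <= 1 ->
  objective (Problem r (ground_truth r k eps) (Omega_tilde r k)) X <= 1 / 100 ->
  `|X p c| < 2.
Proof.
move=> /andP[eps0 eps1] fX; case/mxvec_indexP: p => i a.
have := @entry_objective_le R m r k (ground_truth r k eps) X i i a a.
rewrite eqxx !orbT => /(_ isT) /le_trans /(_ fX).
rewrite block_ground_truth [(_)%:M a a]mxE eqxx mulr1n.
have w0 : 0 < weight k eps i by rewrite /weight; case: ifP.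
have w1 : weight k eps i <= 1 by rewrite /weight; case: ifP.
have : `|X (mxvec_index i a) c| ^+ 2 <= (blockrow X i *m (blockrow X i)^T) a a.
  rewrite real_normK ?num_real // mxE.
  apply: le_trans (@le_sum_term _ _ (fun d => blockrow X i a d * (blockrow X i)^T d a) c _).
    by rewrite !mxE expr2.
  by move=> d; rewrite [X in _ * X]mxE -expr2 sqr_ge0.
have := normr_ge0 (X (mxvec_index i a) c).
move: (`|_|) ((_ *m _) a a) (weight k eps i) w0 w1 => x N w w0 w1 x0 xN Nw.
have ww : w * w <= 1 by nra.
have N2 : N < 4 by nra.
nra.
Qed.

(** * Local minima with prescribed signs *)

Definition signed_center (R : realType) m r (k : 'I_m) (s : 'I_m -> 'I_r -> bool)
    : 'M[R]_(m * r, r) :=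
  stack (fun i => if i == k then 0 else diag_mx (\row_a (-1) ^+ s i a)).

Lemma diag_mx_mul_tr (R : realType) r (u v : 'rV[R]_r) a b :
  (diag_mx u *m (diag_mx v)^T) a b = u 0 a * v 0 b *+ (a == b).
Proof.
rewrite tr_diag_mx mul_diag_mx !mxE.
by case: eqP => [->|]; rewrite ?mulr1n ?mulr0n ?mulr0.
Qed.

(** Blocks avoiding [k] match the measurements exactly, and the others miss by at most [eps] per
    entry, over [(m r)^2] entries. *)
Lemma objective_signed_center (R : realType) m r (k : 'I_m) (eps : R) s :
  0 < eps <= 1 -> ((m * r) ^ 2)%:R * eps ^+ 2 <= 1 / 100 ->
  objective (Problem r (ground_truth r k eps) (Omega_tilde r k))
    (signed_center R k s) <= 1 / 100.
Proof.
move=> /andP[eps0 eps1] small; apply: le_trans small.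
rewrite objective_tildeE; have eps20 : 0 <= eps ^+ 2 := sqr_ge0 _.
have termP i j a b : (if [|| i == k, j == k, i == j | a != b]
    then ((blockrow (signed_center R k s) i *m (blockrow (signed_center R k s) j)^T) a b -
      block (ground_truth r k eps) i j a b) ^+ 2 else 0) <= eps ^+ 2.
  case: ifP => // ijab.
  rewrite !blockrow_stack block_ground_truth [(_)%:M a b]mxE /weight.
  move: ijab.
  have [ik|ik] := eqVneq i k; last have [jk|jk] := eqVneq j k.
  - move=> _; rewrite mul0mx mxE sub0r sqrrN.
    case: (a == b); last by rewrite mulr0n expr0n.
    rewrite mulr1n; case: ifP => _; last by rewrite mulr1.
    by rewrite exprMn ler_piMr // expr_le1 // ltW.
  - move=> _; rewrite trmx0 mulmx0 mxE sub0r sqrrN mul1r.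
    by case: (a == b); rewrite ?mulr1n ?mulr0n ?expr0n.
  - rewrite /= diag_mx_mul_tr !mxE mulr1 => ijab.
    case: (eqVneq a b) ijab => [ab|ab] /=; last by rewrite !mulr0n subrr expr0n.
    by rewrite orbF ab => /eqP ->; rewrite -expr2 sqrr_sign subrr expr0n.
apply: (@le_trans _ _ (\sum_(i < m) \sum_(j < m) \sum_(a < r) \sum_(b < r) eps ^+ 2)).
  by do 4!(apply: ler_sum => ? _).
rewrite !sumr_const !card_ord -!mulrnA mulr_natl.
by rewrite [X in _ *+ X <= _](_ : _ = ((m * r) ^ 2)%N) //; lia.
Qed.

(** Minimize over the compact set of bounded points with signed alignments at least 1/2. The
    minimizer does no worse than the signed center, so it lies in the sublevel set, where every
    constraint is strict; it is therefore an interior, hence local, minimum. *)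
Lemma signed_local_min (R : realType) m r (k j0 : 'I_m) (eps : R)
    (s : 'I_m -> 'I_r -> bool) :
  j0 != k -> (forall a, s j0 a = false) ->
  0 < eps <= 1 -> ((m * r) ^ 2)%:R * eps ^+ 2 <= 1 / 100 ->
  exists X,
    local_min (objective (Problem r (ground_truth r k eps) (Omega_tilde r k))) X /\
    forall j a, j != k -> 0 < (-1) ^+ s j a * alignment j0 X j a.
Proof.
move=> j0k sj0 eps01 small; set f := objective _.
pose g (p : 'I_m * 'I_r) (X : 'M[R]_(m * r, r)) : R :=
  (-1) ^+ s p.1 p.2 * alignment j0 X p.1 p.2.
have g_cont p : continuous (g p).
  move=> X; exact: (cvgM (cvg_cst _) (@alignment_continuous R m r j0 p.1 p.2 X)).
pose B := [set X : 'M[R]_(m * r, r) | forall p c, `|X p c| <= 2].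
(* The block [j0] is constrained too; its alignments are squared row norms, consistent with the plus
   sign imposed by [sj0]. *)
pose A := \bigcap_(p in [set p : 'I_m * 'I_r | p.1 != k])
  (g p @^-1` [set x | 1 / 2 <= x]).
have compactBA : compact (B `&` A).
  apply: compact_closedI; first exact: mx_box_compact.
  apply: closed_bigI => p _; apply: preimage_closed; last exact: closed_ge.
  by move=> X _; exact: g_cont.
have fC : f (signed_center R k s) <= 1 / 100 by exact: objective_signed_center.
have CBA : (B `&` A) (signed_center R k s).
  split; first by move=> p c; rewrite ltW // (entry_lt2 _ _ eps01 fC).
  move=> [j a] /= jk; rewrite /g /alignment /signed_center !blockrow_stack.
  rewrite (negPf j0k) (negPf jk) diag_mx_mul_tr !mxE sj0 eqxx mulr1n expr0 !mul1r.
  by rewrite -expr2 sqrr_sign; lra.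
have f_cont : {within B `&` A, continuous f}.
  exact/continuous_subspaceT/objective_continuous.
have [X XBA minX] := compact_EVT_min (ex_intro _ _ CBA) compactBA f_cont.
have fX : f X <= 1 / 100 by apply: le_trans (minX _ _) fC; rewrite inE.
move: XBA; rewrite inE => -[XB XA].
(* Alignments of absolute value exactly 1/2 are excluded by the gap. *)
have gX p : p.1 != k -> 1 / 2 < g p X.
  move=> pk; have := alignment_sqr_gt p.2 j0k pk fX; have := XA p pk.
  rewrite /g /=; case: (s _ _); rewrite ?expr1 ?expr0 ?mulN1r ?mul1r => h1 h2; nra.
exists X; split; last by move=> j a jk; have := gX (j, a) jk; rewrite /g /= => h; lra.
have nearB : \forall Y \near X, B Y.
  apply: (@filter_forall _ _
    (fun p (Y : 'M[R]_(m * r, r)) => forall c, `|Y p c| <= 2) (nbhs X)) => p.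
  apply: (@filter_forall _ _
    (fun c (Y : 'M[R]_(m * r, r)) => `|Y p c| <= 2) (nbhs X)) => c.
  have X2 : `|X p c| < 2 := entry_lt2 p c eps01 fX.
  have near2 : nbhs X (fun Y : 'M[R]_(m * r, r) => `|Y p c| < 2).
    exact: (cvgr_lt _ (cvg_norm (@coord_continuous R _ _ p c X)) _ X2).
  by apply: filterS near2 => Y /ltW.
have nearA : \forall Y \near X, A Y.
  have : \forall Y \near X, forall p : 'I_m * 'I_r, p.1 != k -> 1 / 2 <= g p Y.
    apply: (@filter_forall _ _
      (fun p (Y : 'M[R]_(m * r, r)) => p.1 != k -> 1 / 2 <= g p Y) (nbhs X)) => p.
    have [pk|pk] := eqVneq p.1 k.
      by apply: nearW => Y.
    have near_half : \forall Y \near X, 1 / 2 < g p Y.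
      exact: (cvgr_gt _ (g_cont p X) _ (gX p pk)).
    by apply: filterS near_half => Y /ltW.
  by apply: filterS => Y YA p /= pk; exact: YA.
apply: filterS2 nearB nearA => Y YB YA.
by apply: minX; rewrite inE.
Qed.

(** * Counting the spurious classes *)

(** At value 0, [X_k^T X_k = eps^2 I], so [eps^2 X_j0 X_j^T = (X_j0 X_k^T) (X_k X_j^T) = eps^2 I];
    cancel [eps^2]. *)
Lemma alignment_eq1 (R : realType) m r (k j0 j : 'I_m) (eps : R) X (a : 'I_r) :
  j0 != k -> j != k -> 0 < eps ->
  objective (Problem r (ground_truth r k eps) (Omega_tilde r k)) X = 0 ->
  alignment j0 X j a = 1.
Proof.
move=> j0k jk eps0 fX; set M := ground_truth r k eps in fX.
have blockE i l : (i == k) || (l == k) ->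
    blockrow X i *m (blockrow X l)^T = block M i l.
  move=> il; apply/matrixP => b c; apply/eqP; rewrite -subr_eq0 -sqrf_eq0.
  rewrite eq_le sqr_ge0 andbT -[X in _ <= X]fX.
  by apply: entry_objective_le; rewrite orbA il.
have Xkj i : i != k -> blockrow X i *m (blockrow X k)^T = eps%:M.
  by move=> ik; rewrite blockE ?eqxx ?orbT // block_ground_truth /weight eqxx (negPf ik) mul1r.
have Xjk i : i != k -> blockrow X k *m (blockrow X i)^T = eps%:M.
  by move=> ik; rewrite blockE ?eqxx // block_ground_truth /weight eqxx (negPf ik) mulr1.
have Xkk : (blockrow X k)^T *m blockrow X k = (eps * eps)%:M.
  have := blockE k k; rewrite eqxx block_ground_truth /weight eqxx => /(_ isT) XX.
  have e2 : eps * eps != 0 by rewrite mulf_neq0 ?gt_eqF.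
  have : blockrow X k *m ((eps * eps)^-1 *: (blockrow X k)^T) = 1%:M.
    by rewrite -scalemxAr XX scale_scalar_mx mulVf.
  move=> /mulmx1C; rewrite -scalemxAl => /(congr1 ( *:%R (eps * eps))).
  by rewrite scalerA mulfV // scale1r scale_scalar_mx mulr1.
have := congr2 mulmx (Xkj _ j0k) (Xjk _ jk).
rewrite mulmxA -[_ *m (blockrow X k)^T *m _]mulmxA Xkk -scalar_mxM.
rewrite -mulmxA mul_scalar_mx -scalemxAr => /matrixP/(_ a a).
rewrite mxE -/(alignment j0 X j a) mxE eqxx mulr1n => e2.
by apply: (mulfI (mulf_neq0 (lt0r_neq0 eps0) (lt0r_neq0 eps0))); rewrite e2 mulr1.
Qed.

Lemma alignment_equivalent (R : realType) m r (X Y : 'M[R]_(m * r, r)) j0 j a :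
  equivalent X Y -> alignment j0 X j a = alignment j0 Y j a.
Proof.
move=> [Q QQ ->]; have QQT : Q *m Q^T = 1%:M by exact: mulmx1C.
have rowQ i : blockrow (X *m Q) i = blockrow X i *m Q.
  by apply/matrixP => b c; rewrite !mxE; apply: eq_bigr => d _; rewrite !mxE.
by rewrite /alignment !rowQ trmx_mul -!mulmxA (mulmxA Q) QQT mul1mx.
Qed.

Definition free_entry m r (k j0 : 'I_m) : pred ('I_m * 'I_r) :=
  [pred p | (p.1 != k) && (p.1 != j0)].

(** The excluded pattern is the all-plus one, realized by the global minimum. *)
Lemma card_sign_patterns m r (k j0 : 'I_m) :
  j0 != k ->
  #|[pred s : {ffun {p | free_entry (r := r) k j0 p} -> bool} | s != [ffun=> false]]| =
  (2 ^ (r * (m - 2)) - 1)%N.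
Proof.
move=> j0k; rewrite cardC1 card_ffun card_bool card_sig -subn1; congr (2 ^ _ - 1)%N.
have -> : #|free_entry (r := r) k j0| = #|[predX [predC [:: k; j0]] & 'I_r]|.
  by apply: eq_card => p; rewrite !inE negb_or andbT.
rewrite cardX card_ord mulnC; congr (_ * _)%N.
have cardkj0 : #|[:: k; j0]| = 2%N by apply/card_uniqP; rewrite /= inE eq_sym j0k.
have := cardC (mem [:: k; j0]); rewrite card_ord cardkj0.
by move=> /(congr1 (subn^~ 2)); rewrite addKn.
Qed.

(** The default [false] puts the plus sign on [j0], as [signed_local_min] requires. *)
Definition sign_of m r (k j0 : 'I_m) (s : {ffun {p | free_entry (r := r) k j0 p} -> bool})
    (j : 'I_m) (a : 'I_r) : bool :=
  oapp s false (insub (j, a)).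

(** Each pattern is recovered from the alignment signs of its local minimum, which depend only on
    the class; hence distinct patterns give distinct classes. *)
Lemma card_spurious_classes (R : realType) m r (k j0 : 'I_m) (eps : R) :
  j0 != k -> 0 < eps <= 1 -> ((m * r) ^ 2)%:R * eps ^+ 2 <= 1 / 100 ->
  (`I_(2 ^ (r * (m - 2)) - 1)%N #<= spurious_classes
     (objective (Problem r (ground_truth r k eps) (Omega_tilde r k))))%card.
Proof.
move=> j0k eps01 small; set f := objective _.
pose S := {ffun {p | free_entry (r := r) k j0 p} -> bool}.
have /choice[X XP] (s : S) : exists X, local_min f X /\
    forall j a, j != k -> 0 < (-1) ^+ sign_of s j a * alignment j0 X j a.
  apply: signed_local_min => // a; rewrite /sign_of insubN //.
  by rewrite /free_entry /= eqxx andbF.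
have sX (s : S) j a : j != k -> sign_of s j a = (alignment j0 (X s) j a < 0).
  move=> /((XP s).2 j a); case: sign_of; rewrite ?expr1 ?expr0 ?mulN1r ?mul1r.
    by rewrite oppr_gt0.
  by move=> /ltW; rewrite ltNge => ->.
have sE (s : S) p : s p = sign_of s (val p).1 (val p).2.
  by rewrite /sign_of -surjective_pairing valK.
pose cls s := [set Y | equivalent (X s) Y].
have cls_inj : injective cls.
  move=> s t st; have Xst : equivalent (X s) (X t).
    have : cls t (X t) by exists 1%:M; rewrite ?trmx1 ?mulmx1.
    by rewrite -st.
  apply/ffunP => p; have pk : (val p).1 != k by case/andP: (valP p).
  by rewrite !sE !sX // (alignment_equivalent _ _ _ Xst).
rewrite -(card_sign_patterns r j0k); set T := [pred s | _].
have /card_eqPle[leI _] := @card_II #|T|; apply: card_le_trans leI _.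
pose h (i : 'I_#|T|) := cls (enum_val i).
have h_inj : {in [set: 'I_#|T|] &, injective h}.
  by move=> i j _ _ /cls_inj /enum_val_inj.
have /card_eqPle[_ leh] := inj_card_eq h_inj; apply: card_le_trans leh _.
apply: subset_card_le => _ [i _ <-]; exists (X (enum_val i)) => //.
have := enum_valP i; rewrite inE; set s := enum_val i => s0.
split; first exact: (XP s).1.
have inf_le0 : inf (range f) <= 0.
  have W0 : f (stack (fun i => (weight k eps i)%:M)) = 0.
    rewrite /f /objective /ground_truth subrr /frobenius big1 ?sqrtr0 ?expr0n // => p _.
    by rewrite big1 // => q _; rewrite !mxE if_same expr0n.
  rewrite -[leRHS]W0; apply: ge_inf; last by eexists.
  by exists 0 => _ [Y _ <-]; exact: objective_ge0.
(* Value 0 would force all alignments to be 1, hence the all-plus pattern, which [T] omits. *)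
apply: (le_lt_trans inf_le0); rewrite lt_neqAle objective_ge0 andbT eq_sym.
apply: contra s0 => /eqP fX0; apply/eqP/ffunP => p; rewrite ffunE sE.
have pk : (val p).1 != k by case/andP: (valP p).
have eps0 : 0 < eps by case/andP: eps01.
by rewrite sX // (alignment_eq1 _ j0k pk eps0 fX0) ltr10.
Qed.

(** * Choice of [eps] and the degenerate case [r = 0] *)

Theorem corollary4 (R : realType) (m r : nat) (k : 'I_m) (hm : (2 * r <= m)%N) :
  (forall M : 'M[R]_(m * r),
     psd M -> \rank M = r ->
     (forall i j : 'I_m, \rank (block M i j) = r) ->
     class_L (star_graph k) (Problem r M (Omega_tilde r k))) /\
  (exists M : 'M[R]_(m * r),
     [/\ psd M /\ \rank M = r,
         forall i j : 'I_m, \rank (block M i j) = r,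
         (`I_(2 ^ (r * (m - 2)) - 1)%N #<=
            spurious_classes (objective (Problem r M (Omega_tilde r k))))%card
       & forall X : 'M[R]_(m * r, r),
           ~ spurious (objective (Problem r M (Omega_star r k))) X]).
Proof.
split; first by move=> M; exact: star_class_L.
(* This yields [m r eps <= 1/10]; the successor keeps the denominator nonzero when [r = 0]. *)
pose eps : R := (10 * (m * r).+1%:R)^-1.
have d0 : 1 <= (m * r).+1%:R :> R by rewrite ler1n.
have eps0 : 0 < eps by rewrite invr_gt0; lra.
have epsd : eps * (10 * (m * r).+1%:R) = 1 by rewrite mulVf //; apply: lt0r_neq0; lra.
have eps1 : eps <= 1 by nra.
have small : ((m * r) ^ 2)%:R * eps ^+ 2 <= 1 / 100.
  rewrite natrX -exprMn; move: epsd; rewrite -[(m * r).+1]addn1 natrD.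
  have := ler0n R (m * r); move: ((m * r)%:R : R) => d d_ge0 epsd.
  have deps0 : 0 <= d * eps by rewrite mulr_ge0 // ltW.
  have : d * eps <= 1 / 10 by lra.
  by move: (d * eps) deps0 => x x0 x1; nra.
(* Here [2 r <= m] with [r] positive supplies a second block. *)
have other : (0 < r)%N -> exists j0, j0 != k.
  move=> r0; have /card_gt1P[i [j [_ _ ij]]] : (1 < #|'I_m|)%N by rewrite card_ord; lia.
  by have [ik|] := eqVneq i k; [exists j; rewrite eq_sym -ik|exists i].
exists (ground_truth r k eps); split.
- by split; [exact: psd_gram|exact: mxrank_ground_truth].
- by move=> i j; exact: mxrank_block_ground_truth.
- have [r0|r0] := posnP r.
    (* For [r = 0] the required number of classes is [2^0 - 1 = 0]. *)
    have -> : (2 ^ (r * (m - 2)) - 1 = 0)%N by rewrite r0 mul0n.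
    by rewrite II0; exact: card_ge0.
  have [j0 j0k] := other r0.
  by apply: card_spurious_classes j0k _ small; rewrite eps0.
- move=> X spX; have [r0|r0] := posnP r.
    apply: not_spurious_of_eq0 (spX); rewrite objectiveE big1 // => p _.
    by case/mxvec_indexP: p => i a; exfalso; move: a; rewrite r0 => -[].
  apply: not_spurious_of_eq0 (spX); apply: local_min_star_eq0 spX.1.
    by rewrite trmx_mul trmxK.
  have [j0 j0k] := other r0.
  exists j0 => //; rewrite -row_free_unit -row_leq_rank.
  by rewrite mxrank_block_ground_truth.
Qed.
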